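(* Let $\mu$ be a probability measure on $\mathbb{R}$ with bounded support, and let $$u(t,x) \,=\, \frac{\int z\,e^{-zx/2 + z^2t/4} \,d\mu(z)}{\int e^{-zx/2 + z^2t/4} \,d\mu(z)}\,, \qquad t \in \mathbb{R}\,, \quad x \in \mathbb{R}\,.$$ For $c\in\mathbb{R}$ with $c\notin\mathrm{supp}(\mu)$ define $$m_-(c) = \sup\{z<c \mid z\in \mathrm{supp}(\mu)\}\,,\qquad m_+(c) = \inf\{z>c \mid z\in \mathrm{supp}(\mu)\}\,.$$ If $c\notin\mathrm{supp}(\mu)$ and $c\neq (m_+(c)+m_-(c))/2$, then $$\lim_{t\to -\infty} u(t,\cdot + ct) \,=\, \begin{cases} m_-(c) & \text{if } c<(m_+(c)+m_-(c))/2\,,\\ m_+(c) & \text{if } c>(m_+(c)+m_-(c))/2\,,\end{cases}$$ where convergence is understood in $L^\infty_{\mathrm{loc}}(\mathbb{R})$.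
   Context: Convergence in $L^\infty_{\mathrm{loc}}(\mathbb{R})$ means uniform convergence on every compact interval $[-R,R]$. Conventions: $\sup\emptyset=-\infty$, $\inf\emptyset=+\infty$; since $\mathrm{supp}(\mu)$ is nonempty, $m_-(c)$ and $m_+(c)$ are not both infinite, so $m_+(c)+m_-(c)\in[-\infty,+\infty]$ is well defined. The function $u$ is a bounded entire solution of Burgers' equation $\partial_t u+u\,\partial_x u=\partial_x^2 u$. *)

(* Defs.v *)
From HB Require Import structures.
From mathcomp Require Import all_boot all_order all_algebra.
From mathcomp Require Import all_classical all_reals all_analysis.
Set Implicit Arguments.
Unset Strict Implicit.
Unset Printing Implicit Defensive.
Import Order.TTheory GRing.Theory Num.Theory.
Import numFieldNormedType.Exports.
Local Open Scope classical_set_scope.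
Local Open Scope ring_scope.

Section burgers_entire_solution.
Context {R : realType}.
Implicit Types (mu : probability (measurableTypeR R) R) (c t x : R).

(* Topological support: quantifying over open neighbourhoods only keeps mu
   applied to measurable sets. *)
Definition msupp mu : set R :=
  [set z | forall U : set R, open_nbhs z U -> (0 < mu U)%E].

Definition burgers_sol mu t x : R :=
  (\int[mu]_z (z * expR (- (z * x) / 2 + z ^+ 2 * t / 4))) /
  (\int[mu]_z expR (- (z * x) / 2 + z ^+ 2 * t / 4)).

(* Extended-real valued, so that sup set0 = -oo and inf set0 = +oo. *)
Definition mminus mu c : \bar R :=
  ereal_sup [set z%:E | z in [set z : R | z < c] `&` msupp mu].

Definition mplus mu c : \bar R :=
  ereal_inf [set z%:E | z in [set z : R | c < z] `&` msupp mu].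

(* The conventional value of (+oo) + (-oo) plays no role: the support of mu is
   nonempty, so at most one summand is infinite when c lies outside it. *)
Definition midpoint mu c : \bar R :=
  ((mplus mu c + mminus mu c) / 2%:E)%E.

(* Convergence in L^oo_loc(R). *)
Definition cvg_locally_uniformly
    (F : set_system (R -> R)) (f : R -> R) : Prop :=
  forall r : R, {uniform `[- r, r], F --> f}.

End burgers_entire_solution.

(* Main.v *)
Require Import Defs.
From mathcomp Require Import all_boot all_order all_algebra.
From mathcomp Require Import all_classical all_reals all_analysis.
From mathcomp Require Import measurable_realfun ring lra.
Import Order.TTheory GRing.Theory Num.Theory.
Import numFieldNormedType.Exports.
Local Open Scope classical_set_scope.
Local Open Scope ring_scope.

(** Completing the square, the weight of the point [z] in [u(t, x + c t)] is,
    up to a factor independent of [z],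
      [exp (t/4 (z - c)^2 - z x / 2)].
    For [t] very negative this is a narrow Gaussian centred at [c], while
    [exp (- z x / 2)] stays between two positive constants as long as [z] is
    in the bounded support and [x] in a compact interval. So [u] is a mean of
    [z] under weights which, relative to one another, concentrate on the
    points of the support that are nearest to [c] (Laplace's method). These
    can only be [mminus] and [mplus]; when [c] is not their midpoint one of
    them, [l], is strictly nearer than the other, and the mean tends to [l].

    Two facts turn this into estimates. First, the complement of the support
    is a null set, so that only points of the support matter
    ([measure_setC_msupp]). Secondly, if [|z - l| w(z) <= eps w(z) + K] on the
    support and [w >= kappa] on a set [B], the weighted mean is within
    [eps + K / (kappa mu(B))] of [l] ([weighted_mean_close]). Here [B] is a
    ball of radius [delta / 2] around [l], and [K] bounds the contribution of
    the points whose distance to [c] is at least [|l - c| + delta]. Then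
    [K / kappa] is a constant times
    [exp (t/4 ((|l - c| + delta)^2 - (|l - c| + delta/2)^2))], which tends to
    [0] as [t] tends to minus infinity; and [mu(B) > 0] exactly because [l]
    belongs to the support ([burgers_sol_close], [burgers_sol_cvg_nearest]).

    What remains is to read off from the definition of [midpoint], infinite
    values included, that [l] is finite, lies in the support, and is separated
    from the rest of the support in the sense needed above
    ([mminus_nearest], [mplus_nearest]). *)

(** * The support of a probability measure *)

Lemma closed_msupp (R : realType) (mu : probability (measurableTypeR R) R) :
  closed (msupp mu).
Proof.
move=> z clz U oU.
have [y [Sy Uy]] := clz U (open_nbhs_nbhs oU).
by apply: Sy; split => //; case: oU.
Qed.

Lemma measurable_msupp (R : realType) (mu : probability (measurableTypeR R) R) :
  measurable (msupp mu : set (measurableTypeR R)).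
Proof. by apply: closed_measurable; exact: closed_msupp. Qed.

(** By definition a point outside the support has a null open neighbourhood.
    Shrinking it to an interval with rational endpoints leaves only countably
    many null sets, and these cover the complement. *)
Lemma measure_setC_msupp (R : realType)
  (mu : probability (measurableTypeR R) R) : mu (~` msupp mu) = 0%E.
Proof.
apply: measure_negligible; first by apply: measurableC; exact: measurable_msupp.
pose I (pq : rat * rat) : set (measurableTypeR R) :=
  `]ratr pq.1, ratr pq.2[%classic.
pose F n : set (measurableTypeR R) :=
  if @unpickle (rat * rat)%type n is Some pq then
    if mu (I pq) == 0%E then I pq else set0
  else set0.
have Fnegl n : mu.-negligible (F n).
  rewrite /F; case: unpickle => [pq|]; last exact: negligible_set0.
  case: eqP => [I0|_]; last exact: negligible_set0.
  by exists (I pq); split => //; exact: measurable_itv.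
apply: negligibleS (negligible_bigcup Fnegl) => z /= /existsNP[U].
move=> /not_implyP[[oU Uz] /negP]; rewrite -leNgt measure_le0 => /eqP U0.
have /nbhs_ballP[e /= e0 eU] : nbhs z U by exact: open_nbhs_nbhs.
have /rat_in_itvoo[p] : z - e < z by rewrite ltrBlDr ltrDl.
have /rat_in_itvoo[q] : z < z + e by rewrite ltrDl.
rewrite !in_itv /= => /andP[zq qe] /andP[ep pz].
exists (pickle (p, q)); [exact: Logic.I|rewrite /F pickleK].
suff -> : mu (I (p, q)) = 0%E by rewrite eqxx /I /= in_itv /= pz zq.
have IU : I (p, q) `<=` U.
  move=> y; rewrite /I /= in_itv /= => /andP[py yq]; apply: eU.
  rewrite /ball /= ltr_distlC; apply/andP; split; first exact: lt_trans py.
  exact: lt_trans qe.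
apply/eqP; rewrite -measure_le0 -U0; apply: le_measure => //.
- by apply: mem_set; exact: measurable_itv.
- by apply: mem_set; exact: open_measurable.
Qed.

Lemma msupp_neq0 (R : realType) (mu : probability (measurableTypeR R) R) :
  msupp mu !=set0.
Proof.
apply/set0P/eqP => S0.
have := measure_setC_msupp R mu; rewrite S0 setC0 probability_setT.
by move/eqP; rewrite onee_eq0.
Qed.

(** * Weighted means *)

Lemma Rintegral_null_setC (d : measure_display) (T : measurableType d)
    (R : realType) (mu : {measure set T -> \bar R}) (S : set T) (f : T -> R) :
  measurable S -> mu (~` S) = 0%E -> mu.-integrable S (EFin \o f) ->
  measurable_fun setT f ->
  \int[mu]_z f z = \int[mu]_(z in S) f z.
Proof.
move=> mS S0 intf mf; rewrite /Rintegral; congr fine.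
have DS : setT `\` ~` S = S by rewrite setTD setCK.
rewrite (negligible_integral (measurableC mS)) ?DS//.
rewrite (negligible_integrable (measurableC mS)) ?DS//.
exact/measurable_EFinP.
Qed.

(** The difference is [(\int (X - l) w) / (\int w)]. The hypothesis on
    [|X - l| w] bounds the numerator by [eps \int w + K], and restricting to
    [B] bounds the denominator below by [kappa mu(B)]. *)
Lemma weighted_mean_close (d : measure_display) (T : measurableType d)
    (R : realType) (mu : probability T R) (S B : set T) (X w : T -> R)
    (l M W eps K kappa : R) :
  measurable S -> measurable B ->
  measurable_fun setT X -> measurable_fun setT w ->
  mu (~` S) = 0%E -> (0 < mu B)%E ->
  (forall z, S z -> `|X z| <= M) -> (forall z, S z -> 0 <= w z <= W) ->
  0 <= K -> 0 < kappa ->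
  (forall z, S z -> `|X z - l| * w z <= eps * w z + K) ->
  (forall z, S z -> B z -> kappa <= w z) ->
  `|(\int[mu]_z (X z * w z)) / (\int[mu]_z w z) - l|
     <= eps + K / (kappa * fine (mu B)).
Proof.
move=> mS mB mX mw S0 B0 SM SW K0 k0 near lower.
have mufin A : measurable A -> (mu A < +oo)%E.
  by move=> mA; rewrite ltey_eq fin_num_measure.
have intb (f : T -> R) (b : R) : measurable_fun setT f ->
    (forall z, S z -> `|f z| <= b) -> mu.-integrable S (EFin \o f).
  move=> mf fb; apply: measurable_bounded_integrable => //.
  - exact: mufin.
  - exact: measurable_funTS.
  - exists b; split=> [|N]; first exact: num_real.
    by move=> /ltW bN z /fb /le_trans; apply.
have mzw : measurable_fun setT (fun z => X z * w z).
  exact: measurable_funM.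
have iw : mu.-integrable S (EFin \o w).
  by apply: (intb _ W) => // z /SW/andP[w0 wW]; rewrite ger0_norm.
have izw : mu.-integrable S (EFin \o (fun z => X z * w z)).
  apply: (intb _ (M * W)) => // z Sz; have /andP[w0 wW] := SW z Sz.
  by rewrite normrM ler_pM// ?SM// ger0_norm.
have ic b : mu.-integrable S (EFin \o cst b) by apply: (intb _ `|b|).
have ilw b : mu.-integrable S (EFin \o (fun z => b * w z)).
  apply: (intb _ (`|b| * W)) => [|z /SW/andP[w0 wW]].
    exact: measurable_funM.
  by rewrite normrM (ger0_norm w0) ler_wpM2l.
rewrite (Rintegral_null_setC _ _ _ _ _ _ mS S0 iw)//.
rewrite (Rintegral_null_setC _ _ _ _ _ _ mS S0 izw)//.
set Iw := \int[mu]_(z in S) w z; set Izw := \int[mu]_(z in S) (X z * w z).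
have muB : 0 < fine (mu B) by rewrite fine_gt0// B0 mufin.
have Iw_ge : kappa * fine (mu B) <= Iw.
  have -> : mu B = mu (S `&` B).
    rewrite (measureDI mu mB mS) setIC.
    rewrite [X in (X + _)%E](_ : _ = 0%E) ?add0e//.
    apply/eqP; rewrite -measure_le0 -S0; apply: le_measure.
    - by apply: mem_set; exact: measurableD.
    - by apply: mem_set; exact: measurableC.
    - by move=> z [].
  have mSB : measurable (S `&` B) by exact: measurableI.
  rewrite -(Rintegral_cst mu mSB) Rintegral_mkcondr; apply: le_Rintegral => //.
    apply: (intb _ kappa).
      exact: (measurable_restrictT _ mB).1 (measurable_cst _).
    move=> z _; rewrite patchE; case: ifPn => _ /=; last by rewrite normr0 ltW.
    by rewrite gtr0_norm.
  move=> z Sz; rewrite patchE; case: ifPn => [/set_mem Bz|_].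
    exact: lower.
  by case/andP: (SW z Sz).
have Iw0 : 0 < Iw by apply: lt_le_trans Iw_ge; exact: mulr_gt0.
have num : `|Izw - l * Iw| <= eps * Iw + K.
  rewrite -RintegralZl// -RintegralB//.
  apply: le_trans (le_normr_Rintegral mS _) _.
    exact: (integrableB mS izw (ilw l)).
  apply: (@le_trans _ _ (\int[mu]_(z in S) (eps * w z + cst K z))).
    apply: le_Rintegral => //.
    - exact: (integrable_norm (integrableB mS izw (ilw l))).
    - exact: (integrableD mS (ilw eps) (ic K)).
    - move=> z Sz; rewrite -mulrBl normrM (ger0_norm (_ : 0 <= w z)) ?near//.
      by case/andP: (SW z Sz).
  rewrite RintegralD// RintegralZl// Rintegral_cst// lerD2l.
  rewrite ler_piMr// -[leRHS]/(fine 1%E) fine_le ?fin_num_measure//.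
  exact: probability_le1.
have -> : Izw / Iw - l = (Izw - l * Iw) / Iw by field; rewrite gt_eqF.
rewrite normrM normfV (gtr0_norm Iw0) ler_pdivrMr//.
apply: le_trans num _; rewrite mulrDl lerD2l.
rewrite mulrAC ler_pdivlMr ?mulr_gt0// ler_wpM2l//.
Qed.

(** * Concentration of the weights near the closest support point *)

(** Completing the square in the moving frame: all of the large parameter [t]
    sits in front of [(z - c)^2], apart from a term that does not depend on
    [z] and cancels in the quotient defining [burgers_sol]. *)
Lemma weight_exponent_shift (R : realType) (c t x z : R) :
  - (z * (x + c * t)) / 2 + z ^+ 2 * t / 4
    = t / 4 * (z - c) ^+ 2 - t / 4 * c ^+ 2 - z * x / 2.
Proof. by field. Qed.

(** The ball around [l] is taken with radius [delta / 2] rather than [delta]: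
    its points are then closer to [c] than the far points by at least
    [delta / 2], and this margin makes the exponential small. Without any
    gap between the two regions the quotient of the weights would not decay. *)
Lemma burgers_sol_close (R : realType)
    (mu : probability (measurableTypeR R) R) (c l M r eps delta t x : R) :
  (forall z, msupp mu z -> `|z| <= M) -> msupp mu l ->
  0 <= eps -> 0 < delta ->
  (forall z, msupp mu z ->
     `|z - l| <= eps \/ `|l - c| + delta <= `|z - c|) ->
  t <= 0 -> `|x| <= r ->
  `|burgers_sol mu t (x + c * t) - l| <= eps +
     2 * M / fine (mu (ball l (delta / 2))) *
     expR (t / 4 * ((`|l - c| + delta) ^+ 2 - (`|l - c| + delta / 2) ^+ 2)
           + M * r).
Proof.
move=> SM Sl eps0 delta0 sep t0 xr.
set d := `|l - c|; have d0 : 0 <= d by exact: normr_ge0.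
have M0 : 0 <= M by exact: le_trans (SM _ Sl).
have zx z : msupp mu z -> `|z * x / 2| <= M * r / 2.
  by move=> Sz; rewrite !normrM (@ger0_norm _ 2^-1)// ler_wpM2r// ler_pM// SM.
pose w (z : measurableTypeR R) :=
  expR (- (z * (x + c * t)) / 2 + z ^+ 2 * t / 4).
pose B : set (measurableTypeR R) := ball l (delta / 2).
(* On far points |z - l| <= 2 M, and t <= 0 makes the weight decrease with
   the distance to c. *)
pose K := 2 * M * expR (t / 4 * ((d + delta) ^+ 2 - c ^+ 2) + M * r / 2).
pose kappa := expR (t / 4 * ((d + delta / 2) ^+ 2 - c ^+ 2) - M * r / 2).
pose W := expR (- (t / 4 * c ^+ 2) + M * r / 2).
have oB : open (ball l (delta / 2)) by exact: ball_open.
have mB : measurable B by exact: open_measurable.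
have B0 : (0 < mu B)%E.
  by apply: Sl; split => //; apply: ballxx; rewrite divr_gt0.
have mw : measurable_fun setT w.
  apply: measurableT_comp; first exact: measurable_expR.
  apply: measurable_funD; apply: measurable_funM => //.
    by apply: measurableT_comp => //; exact: measurable_funM.
  exact: measurable_funM.
have -> : eps + 2 * M / fine (mu (ball l (delta / 2))) *
     expR (t / 4 * ((d + delta) ^+ 2 - (d + delta / 2) ^+ 2) + M * r) =
     eps + K / (kappa * fine (mu B)).
  have m0 : fine (mu B) != 0.
    by rewrite gt_eqF// fine_gt0// B0 ltey_eq fin_num_measure.
  congr (_ + _); rewrite (_ : _ + M * r =
    (t / 4 * ((d + delta) ^+ 2 - c ^+ 2) + M * r / 2) -
    (t / 4 * ((d + delta / 2) ^+ 2 - c ^+ 2) - M * r / 2)); last by field.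
  rewrite expRB -/kappa /K; field.
  by rewrite m0 gt_eqF ?expR_gt0.
apply: (@weighted_mean_close _ _ R mu (msupp mu) B id w l M W) => //.
- exact: measurable_msupp.
- exact: measure_setC_msupp.
- move=> z Sz; rewrite expR_ge0 ler_expR weight_exponent_shift /=.
  have := zx z Sz; rewrite ler_norml => /andP[zx1 zx2].
  have h : t / 4 * (z - c) ^+ 2 <= 0 by rewrite mulr_le0_ge0 ?sqr_ge0//; lra.
  lra.
- by rewrite mulr_ge0 ?expR_ge0// mulr_ge0.
- exact: expR_gt0.
- move=> z Sz; have [zl|zfar] := sep z Sz.
    apply: (@le_trans _ _ (eps * w z)); first by rewrite ler_wpM2r ?expR_ge0.
    by rewrite lerDl mulr_ge0 ?expR_ge0// mulr_ge0.
  apply: (@le_trans _ _ K); last by rewrite lerDr mulr_ge0 ?expR_ge0.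
  apply: ler_pM => //; first exact: expR_ge0.
    rewrite (le_trans (ler_normB _ _))//.
    by rewrite (_ : 2 * M = M + M) ?lerD ?SM//; ring.
  rewrite ler_expR weight_exponent_shift.
  have := zx z Sz; rewrite ler_norml => /andP[zx1 zx2].
  have h : t / 4 * (z - c) ^+ 2 <= t / 4 * (d + delta) ^+ 2.
    apply: ler_wnM2l; first lra.
    rewrite -[leRHS]real_normK ?num_real// lerXn2r ?nnegrE//.
    exact: addr_ge0 d0 (ltW delta0).
  lra.
- move=> z Sz; rewrite /B /ball /= => zl.
  rewrite ler_expR weight_exponent_shift.
  have := zx z Sz; rewrite ler_norml => /andP[zx1 zx2].
  have h : t / 4 * (d + delta / 2) ^+ 2 <= t / 4 * (z - c) ^+ 2.
    apply: ler_wnM2l; first lra.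
    rewrite -[leLHS]real_normK ?num_real// lerXn2r ?nnegrE//.
      by rewrite addr_ge0// divr_ge0// ltW.
    rewrite (_ : z - c = (l - c) - (l - z)); last by ring.
    by apply: le_trans (ler_normB _ _) _; rewrite lerD2l ltW.
  lra.
Qed.

(** The disjunction describes a support point as either lying behind [l] when
    seen from [c], so that it is farther than [l] by exactly its distance to
    [l], or being at distance at least [g > |l - c|]. Hence every support
    point not close to [l] is farther from [c] than [l] by a fixed amount
    [delta], and the error bound of [burgers_sol_close], which is uniform in
    [x], tends to its first term. *)
Lemma burgers_sol_cvg_nearest (R : realType)
    (mu : probability (measurableTypeR R) R) (c l g : R) :
  bounded_set (msupp mu) -> msupp mu l -> `|l - c| < g ->
  (forall z, msupp mu z ->
     `|l - c| + `|z - l| <= `|z - c| \/ g <= `|z - c|) ->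
  cvg_locally_uniformly
    ((fun t x => burgers_sol mu t (x + c * t)) @ -oo) (cst l).
Proof.
move=> [M0 [_ SM0]] Sl lg nearest r P /uniform_nbhs[E [entE EP]].
move: entE; rewrite -entourage_ballE => -[e /= e0 eE].
have [M M_gt0 SM] : exists2 M, 0 < M & forall z, msupp mu z -> `|z| <= M.
  exists (`|M0| + 1); first by rewrite ltr_wpDl.
  by apply: SM0; rewrite ltr_pwDr// ler_norm.
pose delta := Num.min (e / 3) (g - `|l - c|).
have delta0 : 0 < delta by rewrite lt_min divr_gt0//= subr_gt0.
have sep z : msupp mu z -> `|z - l| <= e / 3 \/ `|l - c| + delta <= `|z - c|.
  move=> Sz; have [zl|zl] := leP `|z - l| (e / 3); [by left|right].
  have [|] := nearest z Sz; apply: le_trans.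
    by rewrite lerD2l ge_min ltW.
  by rewrite addrC -lerBrDr ge_min lexx orbT.
set d := `|l - c| in lg sep; have d0 : 0 <= d by exact: normr_ge0.
pose m := fine (mu (ball l (delta / 2))).
have m0 : 0 < m.
  rewrite fine_gt0// ltey_eq fin_num_measure ?andbT; last first.
    by apply: open_measurable; exact: ball_open.
  apply: Sl; split; first exact: ball_open.
  by apply: ballxx; rewrite divr_gt0.
pose a := ((d + delta) ^+ 2 - (d + delta / 2) ^+ 2) / 4.
have a0 : 0 < a.
  by rewrite divr_gt0// subr_gt0 ltrXn2r// ?nnegrE; lra.
(* eta is the value of the exponential at which the error term is e / 3. *)
pose eta := e / 3 * m / (2 * M).
have eta0 : 0 < eta by rewrite !divr_gt0// ?mulr_gt0// divr_gt0.
have : \forall t \near -oo, t <= Num.min 0 ((ln eta - M * r) / a).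
  by apply: nbhs_ninfty_le; exact: num_real.
apply: filterS => t; rewrite le_min ler_pdivlMr// => /andP[t0 tT].
apply: EP => x /=; rewrite in_itv/= -ler_norml => xr.
apply: eE; rewrite /ball/= distrC.
apply: le_lt_trans
  (burgers_sol_close _ _ _ _ _ _ _ _ _ _ SM Sl _ delta0 sep t0 xr) _.
  by rewrite divr_ge0// ltW.
rewrite -/d -/m.
apply: (@le_lt_trans _ _ (e / 3 + 2 * M / m * eta)); last first.
  rewrite /eta (_ : 2 * M / m * _ = e / 3); first lra.
  by field; rewrite !gt_eqF.
rewrite lerD2l ler_wpM2l//; first by rewrite divr_ge0 ?mulr_ge0// ltW.
rewrite -[leRHS]lnK ?posrE// ler_expR.
suff -> : t / 4 * ((d + delta) ^+ 2 - (d + delta / 2) ^+ 2) = t * a by lra.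
by rewrite /a; field.
Qed.

(** * The nearest support point, read off from the midpoint *)

Lemma mminus_msupp (R : realType) (mu : probability (measurableTypeR R) R)
    (c l : R) :
  mminus mu c = l%:E ->
  [/\ msupp mu l, l <= c & forall z, msupp mu z -> z < c -> z <= l].
Proof.
move=> ml; split.
- apply: closed_msupp => U /nbhs_ballP[e /= e0 eU].
  have [|_ [z [zc Sz] <-]] := @ub_ereal_sup_adherent R
      [set z%:E | z in [set z : R | z < c] `&` msupp mu] e e0.
    by rewrite -/(mminus mu c) ml.
  rewrite -/(mminus mu c) ml -EFinB lte_fin => lz.
  have zl : z <= l by rewrite -lee_fin -ml; apply: ereal_sup_ubound; exists z.
  exists z; split => //; apply: eU; rewrite /ball /= ger0_norm ?subr_ge0//.
  by rewrite ltrBlDr -ltrBlDl.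
- by rewrite -lee_fin -ml; apply: ge_ereal_sup => _ [z [/ltW zc _] <-].
- by move=> z Sz zc; rewrite -lee_fin -ml; apply: ereal_sup_ubound; exists z.
Qed.

Lemma mplus_msupp (R : realType) (mu : probability (measurableTypeR R) R)
    (c l : R) :
  mplus mu c = l%:E ->
  [/\ msupp mu l, c <= l & forall z, msupp mu z -> c < z -> l <= z].
Proof.
move=> ml; split.
- apply: closed_msupp => U /nbhs_ballP[e /= e0 eU].
  have [|_ [z [zc Sz] <-]] := @lb_ereal_inf_adherent R
      [set z%:E | z in [set z : R | c < z] `&` msupp mu] e e0.
    by rewrite -/(mplus mu c) ml.
  rewrite -/(mplus mu c) ml -EFinD lte_fin => lz.
  have zl : l <= z by rewrite -lee_fin -ml; apply: ereal_inf_lbound; exists z.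
  exists z; split => //; apply: eU; rewrite /ball /= ler0_norm ?subr_le0//.
  by rewrite opprB ltrBlDl.
- by rewrite -lee_fin -ml; apply: le_ereal_inf_tmp => _ [z [/ltW zc _] <-].
- by move=> z Sz zc; rewrite -lee_fin -ml; apply: ereal_inf_lbound; exists z.
Qed.

(** The midpoint would be [-oo] if [mminus] were, so [mminus] is a real number
    [l]. Support points below [c] lie behind [l]; those above [c] are at
    distance at least [mplus - c], which exceeds [c - l] as [c] is below the
    midpoint. If [mplus] is [+oo] there are none, and any
    [g > |l - c|] will do. *)
Lemma mminus_nearest (R : realType) (mu : probability (measurableTypeR R) R)
    (c : R) :
  ~ msupp mu c -> (c%:E < midpoint mu c)%E ->
  exists l g : R, [/\ mminus mu c = l%:E, msupp mu l, `|l - c| < g &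
    forall z, msupp mu z ->
      `|l - c| + `|z - l| <= `|z - c| \/ g <= `|z - c|].
Proof.
move=> Sc; rewrite /midpoint inver pnatr_eq0 /=.
case ml: (mminus mu c) => [l| |]; last 2 first.
- have : (mminus mu c <= c%:E)%E.
    by apply: ge_ereal_sup => _ [z [/ltW zc _] <-].
  by rewrite ml.
- by rewrite addeNy gt0_mulNye// lte_fin invr_gt0.
have [Sl lc lmax] := mminus_msupp _ _ _ _ ml.
have side z : msupp mu z -> z < c -> `|l - c| + `|z - l| <= `|z - c|.
  move=> Sz zc; have zl := lmax z Sz zc.
  by rewrite !ler0_norm; lra.
have dE : `|l - c| = c - l by rewrite ler0_norm; lra.
case mp: (mplus mu c) => [m| |] => mid.
- have {}mid : c < (m + l) / 2 by move: mid.
  have [Sm cm mmin] := mplus_msupp _ _ _ _ mp.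
  exists l, (m - c); split => //; first by rewrite dE; lra.
  move=> z Sz; case: (ltgtP z c) => [zc|cz|zc]; [by left; exact: side| |].
    by right; have := mmin z Sz cz; rewrite ger0_norm; lra.
  by move: Sz; rewrite zc.
- exists l, (`|l - c| + 1); split => //; first by rewrite ltrDl.
  move=> z Sz; case: (ltgtP z c) => [zc|cz|zc]; first by left; exact: side.
    have : (mplus mu c <= z%:E)%E by apply: ereal_inf_lbound; exists z.
    by rewrite mp.
  by move: Sz; rewrite zc.
- have : (c%:E <= mplus mu c)%E.
    by apply: le_ereal_inf_tmp => _ [z [/ltW zc _] <-].
  by rewrite mp.
Qed.

(** Mirror image of [mminus_nearest], except when both [mminus] and [mplus] are
    infinite. The value of [midpoint] is then [-oo], which does not conflict
    with the hypothesis; this case is excluded because the support, being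
    nonempty, has a point on one side of [c]. *)
Lemma mplus_nearest (R : realType) (mu : probability (measurableTypeR R) R)
    (c : R) :
  ~ msupp mu c -> (midpoint mu c < c%:E)%E ->
  exists l g : R, [/\ mplus mu c = l%:E, msupp mu l, `|l - c| < g &
    forall z, msupp mu z ->
      `|l - c| + `|z - l| <= `|z - c| \/ g <= `|z - c|].
Proof.
move=> Sc; rewrite /midpoint inver pnatr_eq0 /=.
case ml: (mplus mu c) => [l| |]; last 2 first.
- case mm: (mminus mu c) => [m| |].
  + by rewrite addye// gt0_mulye// lte_fin invr_gt0.
  + by rewrite addye// gt0_mulye// lte_fin invr_gt0.
  + have [z Sz] := msupp_neq0 R mu; case: (ltgtP z c) => [zc|cz|zc].
    * have : (z%:E <= mminus mu c)%E by apply: ereal_sup_ubound; exists z.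
      by rewrite mm.
    * have : (mplus mu c <= z%:E)%E by apply: ereal_inf_lbound; exists z.
      by rewrite ml.
    * by move: Sz; rewrite zc.
- have : (c%:E <= mplus mu c)%E.
    by apply: le_ereal_inf_tmp => _ [z [/ltW zc _] <-].
  by rewrite ml.
have [Sl lc lmin] := mplus_msupp _ _ _ _ ml.
have side z : msupp mu z -> c < z -> `|l - c| + `|z - l| <= `|z - c|.
  move=> Sz zc; have zl := lmin z Sz zc.
  by rewrite !ger0_norm; lra.
have dE : `|l - c| = l - c by rewrite ger0_norm; lra.
case mp: (mminus mu c) => [m| |] => mid.
- have {}mid : (l + m) / 2 < c by move: mid.
  have [Sm cm mmax] := mminus_msupp _ _ _ _ mp.
  exists l, (c - m); split => //; first by rewrite dE; lra.
  move=> z Sz; case: (ltgtP z c) => [zc|cz|zc]; [|by left; exact: side|].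
    by right; have := mmax z Sz zc; rewrite ler0_norm; lra.
  by move: Sz; rewrite zc.
- have : (mminus mu c <= c%:E)%E.
    by apply: ge_ereal_sup => _ [z [/ltW zc _] <-].
  by rewrite mp.
- exists l, (`|l - c| + 1); split => //; first by rewrite ltrDl.
  move=> z Sz; case: (ltgtP z c) => [zc|cz|zc]; last 2 first.
  + by left; exact: side.
  + by move: Sz; rewrite zc.
  have : (z%:E <= mminus mu c)%E by apply: ereal_sup_ubound; exists z.
  by rewrite mp.
Qed.

Theorem proposition1p3 (R : realType)
    (mu : probability (measurableTypeR R) R) (c : R)
    (mu_bounded : bounded_set (msupp mu))
    (c_notin_supp : ~ msupp mu c)
    (c_neq_midpoint : c%:E <> midpoint mu c) :
  exists2 l : R,
    l%:E = (if (c%:E < midpoint mu c)%E then mminus mu c else mplus mu c) &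
    cvg_locally_uniformly
      ((fun t x => burgers_sol mu t (x + c * t)) @ -oo) (cst l).
Proof.
case: (ltgtP c%:E (midpoint mu c)) => [cmid|midc|//].
- have [l [g [-> Sl lg nearest]]] := mminus_nearest _ _ _ c_notin_supp cmid.
  by exists l => //; exact: burgers_sol_cvg_nearest lg nearest.
- have [l [g [-> Sl lg nearest]]] := mplus_nearest _ _ _ c_notin_supp midc.
  by exists l => //; exact: burgers_sol_cvg_nearest lg nearest.
Qed.
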